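(* Fix a state $\mathbf{x}_k\in\mathbb{R}^n$, a convex control set $\mathcal{U}\subset\mathbb{R}^m$, a matrix $\mathbf{R}(\mathbf{x}_k)\in\mathbb{R}^{m\times m}$, scalars $\lambda>0$, $\zeta>0$, and $\tilde p_k\in[0.5,1)$. Suppose that for the control-affine dynamics $\dot{\mathbf{x}}=F(\mathbf{x})\underline{\mathbf{u}}$ we have, for every $\mathbf{u}$, $F(\mathbf{x})\underline{\mathbf{u}}\sim\mathcal{GP}\big(\mathbf{M}_k(\mathbf{x})\underline{\mathbf{u}},\ (\underline{\mathbf{u}}^\top\mathbf{B}_k(\mathbf{x},\mathbf{x}')\underline{\mathbf{u}})\,\mathbf{A}\big)$. Then the chance-constrained problem $$\min_{\mathbf{u}\in\mathcal{U},\,\delta\in\mathbb{R}}\ \|\mathbf{R}(\mathbf{x}_k)\mathbf{u}\|^2+\lambda\delta^2\quad\text{s.t.}\quad \mathbb{P}(\mathrm{CLC}(\mathbf{x}_k,\mathbf{u})\le\delta\mid\mathbf{x}_k,\mathbf{u})\ge\tilde p_k,\quad \mathbb{P}(\mathrm{CBC}(\mathbf{x}_k,\mathbf{u})\ge\zeta\mid\mathbf{x}_k,\mathbf{u})\ge\tilde p_k$$ is equivalent (it has the same minimizers $(\mathbf{u},\delta)$) to the second-order cone program $$\min_{y\in\mathbb{R},\,\delta\in\mathbb{R},\,\mathbf{u}\in\mathcal{U}}\ y\quad\text{s.t.}\quad y-\left\|\begin{bmatrix}\mathbf{R}(\mathbf{x}_k)\mathbf{u}\\ \sqrt{\lambda}\,\delta\end{bmatrix}\right\|_2\ge0,$$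 $$\mathbf{q}_k(\mathbf{x}_k)^\top\underline{\mathbf{u}}-\delta+c(\tilde p_k)\|\mathbf{P}_k(\mathbf{x}_k)\underline{\mathbf{u}}\|_2\le0,\qquad \mathbf{e}_k(\mathbf{x}_k)^\top\underline{\mathbf{u}}-\zeta-c(\tilde p_k)\|\mathbf{V}_k(\mathbf{x}_k)\underline{\mathbf{u}}\|_2\ge0,$$ where $c(\tilde p_k)=\sqrt2\,\mathrm{erf}^{-1}(2\tilde p_k-1)$ and $$\mathbf{q}_k(\mathbf{x}_k)=\mathbf{M}_k(\mathbf{x}_k)^\top\nabla_{\mathbf{x}}V(\mathbf{x}_k)+\begin{bmatrix}\gamma(V(\mathbf{x}_k))\\ \mathbf{0}_m\end{bmatrix},\qquad \mathbf{P}_k(\mathbf{x}_k)=\sqrt{\nabla_{\mathbf{x}}V(\mathbf{x}_k)^\top\mathbf{A}\nabla_{\mathbf{x}}V(\mathbf{x}_k)}\ \mathbf{B}_k^{1/2}(\mathbf{x}_k,\mathbf{x}_k),$$ $$\mathbf{e}_k(\mathbf{x}_k)=\mathbf{M}_k(\mathbf{x}_k)^\top\nabla_{\mathbf{x}}h(\mathbf{x}_k)+\begin{bmatrix}\alpha(h(\mathbf{x}_k))\\ \mathbf{0}_m\end{bmatrix},\qquad \mathbf{V}_k(\mathbf{x}_k)=\sqrt{\nabla_{\mathbf{x}}h(\mathbf{x}_k)^\top\mathbf{A}\nabla_{\mathbf{x}}h(\mathbf{x}_k)}\ \mathbf{B}_k^{1/2}(\mathbf{x}_k,\mathbf{x}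_k).$$
   Context: The system is $\dot{\mathbf{x}}=f(\mathbf{x})+g(\mathbf{x})\mathbf{u}=F(\mathbf{x})\underline{\mathbf{u}}$ with $F(\mathbf{x})=[f(\mathbf{x})\ g(\mathbf{x})]\in\mathbb{R}^{n\times(1+m)}$ and $\underline{\mathbf{u}}=[1,\mathbf{u}^\top]^\top$. $V,h$ are known continuously differentiable real-valued functions; $\gamma$ is a class $K$ function and $\alpha$ an extended class $K_\infty$ function. The control Lyapunov condition is $\mathrm{CLC}(\mathbf{x},\mathbf{u})=\nabla_{\mathbf{x}}V(\mathbf{x})^\top F(\mathbf{x})\underline{\mathbf{u}}+\gamma(V(\mathbf{x}))$ and the control barrier condition is $\mathrm{CBC}(\mathbf{x},\mathbf{u})=\nabla_{\mathbf{x}}h(\mathbf{x})^\top F(\mathbf{x})\underline{\mathbf{u}}+\alpha(h(\mathbf{x}))$. $\mathbf{M}_k(\mathbf{x})\in\mathbb{R}^{n\times(1+m)}$ is the mean of $F(\mathbf{x})$; $\mathbf{A}\in\mathbb{R}^{n\times n}$ and $\mathbf{B}_k(\mathbf{x},\mathbf{x})\in\mathbb{R}^{(1+m)\times(1+m)}$ are symmetric positive semidefinite. $\mathbf{B}_k^{1/2}$ denotes a Cholesky factor of $\mathbf{B}_k(\mathbf{x}_k,\mathbf{x}_k)$, with the convention $\mathbf{B}_k=(\mathbf{B}_k^{1/2})^\top\mathbf{B}_k^{1/2}$. $\mathrm{erf}$ is the Gauss error function. ''Second-order cone program'' means linear objective with second-order cone constraints, in addition to the convex constraint $\mathbf{u}\in\mathcal{U}$.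 *)

(* Defs.v *)
From HB Require Import structures.
From mathcomp Require Import all_boot all_order all_algebra.
From mathcomp Require Import all_classical all_reals all_analysis.

Set Implicit Arguments.
Unset Strict Implicit.
Unset Printing Implicit Defensive.

Import Order.TTheory GRing.Theory Num.Theory.
Import numFieldNormedType.Exports.

Local Open Scope classical_set_scope.
Local Open Scope ring_scope.

(* MathComp and MathComp-Analysis, over an arbitrary [R : realType].
   Points of R^n are column vectors ['cV[R]_n]; 1 x 1 matrices are turned into
   scalars by taking their entry [0 0]. *)

(* Euclidean norm: the library norm [`|v|] on matrices is the sup norm. *)
Definition enorm (R : realType) (n : nat) (v : 'cV[R]_n) : R :=
  Num.sqrt (\sum_(i < n) v i 0 ^+ 2).

Definition psd (R : realType) (n : nat) (S : 'M[R]_n) : Prop :=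
  S^T = S /\ forall a : 'cV[R]_n, 0 <= (a^T *m S *m a) 0 0.

(* [is_trig_mx] means lower triangular, hence [L] is upper triangular. *)
Definition cholesky_factor (R : realType) (n : nat) (S L : 'M[R]_n) : Prop :=
  is_trig_mx L^T /\ S = L^T *m L.

Definition grad (R : realType) (n : nat) (V : 'cV[R]_n -> R) (x : 'cV[R]_n)
  : 'cV[R]_n :=
  \col_(i < n) 'D_(delta_mx i 0) V x.

Definition continuously_differentiable (R : realType) (n : nat)
    (V : 'cV[R]_n -> R) : Prop :=
  (forall x, differentiable V x) /\ continuous (grad V).

(* A class K function has domain [0, a) with 0 < a <= +oo; it is represented
   by a total function whose values outside [0, a) are unconstrained. *)
Definition class_K (R : realType) (gamma : R -> R) : Prop :=
  exists2 a : \bar R, (0 < a)%E &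
    let D := [set t : R | 0 <= t /\ (t%:E < a)%E] in
    [/\ gamma 0 = 0,
        {within D, continuous gamma} &
        forall s t, D s -> D t -> s < t -> gamma s < gamma t].

Definition extended_class_Kinfty (R : realType) (alpha : R -> R) : Prop :=
  [/\ alpha 0 = 0,
      continuous alpha,
      {homo alpha : s t / s < t},
      alpha t @[t --> +oo] --> +oo &
      alpha t @[t --> -oo] --> -oo].

(* For [x < 0] the first domain is empty and the second integral carries the
   orientation; for [x >= 0] the second integral vanishes. *)
Definition erf (R : realType) (x : R) : R :=
  2 / Num.sqrt pi *
  ((\int[lebesgue_measure]_(t in `[0, x]) expR (- t ^+ 2)) -
   (\int[lebesgue_measure]_(t in `[x, 0]) expR (- t ^+ 2))).

(* Inverse of [erf] on its range ]-1, 1[; the value elsewhere is junk. *)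
Definition erfinv (R : realType) (y : R) : R := xget 0 [set x : R | erf x = y].

(* [Y] is a real random variable with law N(mu, s2).  The degenerate case
   s2 = 0 is the Dirac mass at mu; it is separated because the library's
   [normal_prob mu 0], whose second argument is the standard deviation, is the
   uniform law on [0, 1]. *)
Definition normal_rv (d : measure_display) (T : measurableType d)
    (R : realType) (P : probability T R) (Y : T -> R) (mu s2 : R) : Prop :=
  [/\ 0 <= s2,
      measurable_fun setT Y &
      forall D : set R, measurable D ->
        P (Y @^-1` D) =
        if s2 == 0 then \d_mu D else normal_prob mu (Num.sqrt s2) D].

(* Possibly degenerate Gaussian vectors: every linear functional is normal. *)
Definition mvnormal (d : measure_display) (T : measurableType d)
    (R : realType) (P : probability T R) (N : nat) (Y : T -> 'cV[R]_N)
    (mu : 'cV[R]_N) (S : 'M[R]_N) : Prop :=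
  psd S /\
  forall a : 'cV[R]_N,
    normal_rv P (fun w => (a^T *m Y w) 0 0)
      ((a^T *m mu) 0 0) ((a^T *m S *m a) 0 0).

(* Vector-valued Gaussian process with mean function [mu] and matrix-valued
   covariance function [K]: all finite-dimensional marginals are Gaussian. *)
Definition gaussian_process (d : measure_display) (T : measurableType d)
    (R : realType) (P : probability T R) (I : Type) (n : nat)
    (X : I -> T -> 'cV[R]_n) (mu : I -> 'cV[R]_n) (K : I -> I -> 'M[R]_n)
    : Prop :=
  forall (N : nat) (x : 'I_N -> I),
    mvnormal P (fun w => \mxcol_(i < N) X (x i) w)
      (\mxcol_(i < N) mu (x i)) (\mxblock_(i < N, j < N) K (x i) (x j)).

Definition minimizer (R : realType) (E : Type) (feasible : set E)
    (objective : E -> R) (z : E) : Prop :=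
  feasible z /\ forall z', feasible z' -> objective z <= objective z'.

Definition second_order_cone_constraint (R : realType) (E : lmodType R)
    (S : set E) : Prop :=
  exists (k : nat) (C : {linear E -> 'cV[R]_k}) (b : 'cV[R]_k)
         (l : {scalar E}) (c : R),
    S = [set z | enorm (C z + b) <= l z + c].

(* Linear objective, finitely many second-order cone constraints, and
   membership in the convex set [D]. *)
Definition second_order_cone_program (R : realType) (E : lmodType R)
    (D feasible : set E) (objective : E -> R) : Prop :=
  [/\ convex_set D,
      exists l : {scalar E}, objective = l &
      exists (k : nat) (S : 'I_k -> set E),
        (forall i, second_order_cone_constraint (S i)) /\
        feasible = D `&` \bigcap_i S i].

Definition ubar (R : realType) (m : nat) (u : 'cV[R]_m) : 'cV[R]_(1 + m) :=
  col_mx 1%:M u.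

(* The random matrix F(x) = [f(x) g(x)]; [w] is the sample point. *)
Definition dynamics (R : realType) (T : Type) (n m : nat)
    (f : 'cV[R]_n -> T -> 'cV[R]_n) (g : 'cV[R]_n -> T -> 'M[R]_(n, m))
    (x : 'cV[R]_n) (w : T) : 'M[R]_(n, 1 + m) :=
  row_mx (f x w) (g x w).

Definition CLC (R : realType) (T : Type) (n m : nat)
    (F : 'cV[R]_n -> T -> 'M[R]_(n, 1 + m)) (V : 'cV[R]_n -> R)
    (gamma : R -> R) (x : 'cV[R]_n) (u : 'cV[R]_m) (w : T) : R :=
  ((grad V x)^T *m F x w *m ubar u) 0 0 + gamma (V x).

Definition CBC (R : realType) (T : Type) (n m : nat)
    (F : 'cV[R]_n -> T -> 'M[R]_(n, 1 + m)) (h : 'cV[R]_n -> R)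
    (alpha : R -> R) (x : 'cV[R]_n) (u : 'cV[R]_m) (w : T) : R :=
  ((grad h x)^T *m F x w *m ubar u) 0 0 + alpha (h x).

(* Main.v *)
(* A linear functional of the Gaussian vector F(x) ubar is a scalar N(mu, s^2)
   variable, so each chance constraint reads Phi ((y - mu) / s) >= p, where
   Phi z = (1 + erf (z / sqrt 2)) / 2.  As erf is increasing and maps
   [0, +oo[ onto [0, 1[, this is mu - y + c(p) s <= 0, and the Cholesky factor
   turns s into a Euclidean norm.  For p >= 1/2 the coefficient c(p) is
   nonnegative, which is what makes the constraint a second-order cone.
   Finally the chance objective is the square of the norm bounded by the
   epigraph variable y, and squaring preserves minimizers. *)
Require Import Defs.
From HB Require Import structures.
From mathcomp Require Import all_boot all_order all_algebra.
From mathcomp Require Import all_classical all_reals all_analysis.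
From mathcomp Require Import measurable_realfun ring lra.

Set Implicit Arguments.
Unset Strict Implicit.
Unset Printing Implicit Defensive.

Import Order.TTheory GRing.Theory Num.Theory.
Import numFieldNormedType.Exports.

Local Open Scope classical_set_scope.
Local Open Scope ring_scope.

(** * The error function, its inverse, and the normal distribution function *)

Section gaussian_integral.
Context {R : realType}.
Implicit Types a b x y z mu s : R.
Local Notation leb := (@lebesgue_measure R).
Local Notation spi := (Num.sqrt (pi : R)).

(** Starting the integral at minus infinity gives one formula for both signs of the argument, and it
    is the half-line on which [normal_prob] is evaluated below. *)
Definition gauss_primitive z : R := \int[leb]_(t in `]-oo, z]) gauss_fun t.

Lemma sqrt_pi_gt0 : 0 < spi.
Proof. by rewrite sqrtr_gt0 pi_gt0. Qed.

Lemma integrable_gauss (i : interval R) :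
  leb.-integrable [set` i] (EFin \o gauss_fun).
Proof.
by apply: (@integrableS _ _ _ _ setT) => //; exact: integrableT_gauss.
Qed.

Lemma gauss_primitiveB a b : a <= b ->
  gauss_primitive b - gauss_primitive a = \int[leb]_(t in `[a, b]) gauss_fun t.
Proof.
move=> ab; rewrite /gauss_primitive Rintegral_itvB ?bnd_simp//.
  by rewrite Rintegral_itv_obnd_cbnd//; exact: integrable_gauss.
exact: integrable_gauss.
Qed.

(** The integrand is even, so the reflection of [t] to [-t] yields the known half-line Gaussian
    integral. *)
Lemma gauss_primitive0 : gauss_primitive 0 = spi / 2.
Proof.
rewrite /gauss_primitive /Rintegral -[in LHS]oppr0 ge0_integration_by_substitutionNy.
- rewrite (_ : _ \o -%R = gauss_fun) ?integral0y_gauss//.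
  by apply/funext => x /=; rewrite /gauss_fun sqrrN.
- apply: continuous_subspaceT; exact: continuous_gauss_fun.
- by move=> x _; exact: gauss_fun_ge0.
Qed.

Lemma gauss_primitive_lt a b : a < b -> gauss_primitive a < gauss_primitive b.
Proof.
move=> ab; rewrite -subr_gt0 gauss_primitiveB ?ltW//.
(* On [[a, b]] one has |t| <= |a| + |b|, so [k] is a positive lower bound of the integrand and the
   integral is at least [k * (b - a)]. *)
pose k := gauss_fun (`|a| + `|b|).
have k0 : 0 < k by exact: expR_gt0.
apply: (@lt_le_trans _ _ (k * (b - a))); first by rewrite mulr_gt0// subr_gt0.
have muab : leb `[a, b] = (b - a)%:E.
  by rewrite lebesgue_measure_itv/= lte_fin ab EFinB.
rewrite -[b - a]/(fine (b - a)%:E) -muab -Rintegral_cst//.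
apply: le_Rintegral => //=.
- apply: continuous_compact_integrable; first exact: segment_compact.
  by apply: continuous_subspaceT => x; exact: cst_continuous.
- exact: integrable_gauss.
- move=> x; rewrite in_itv/= => /andP[ax xb].
  rewrite ler_expR lerN2 -real_normK ?num_real// lerXn2r ?nnegrE ?addr_ge0//.
  rewrite ler_norml; apply/andP; split.
    by have := ler_norm (- a); have := normr_ge0 b; rewrite normrN; lra.
  by have := ler_norm b; have := normr_ge0 a; lra.
Qed.

(** Merges the two oriented integrals of [erf] into an increasing affine function of
    [gauss_primitive], through which order and normal probabilities are both handled. *)
Lemma erfE z : erf z = 2 / spi * gauss_primitive z - 1.
Proof.
suff -> : erf z = 2 / spi * (gauss_primitive z - gauss_primitive 0).
  by rewrite gauss_primitive0; field; rewrite gt_eqF// sqrt_pi_gt0.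
rewrite /erf; congr (_ * _); have [z0|z0] := leP 0 z.
  rewrite gauss_primitiveB//; move: z0; rewrite le_eqVlt => /orP[/eqP <-|z0].
    by rewrite subrr set_itv1 Rintegral_set1.
  have -> : \int[leb]_(t in `[z, 0]) expR (- t ^+ 2) = 0.
    by rewrite set_itv_ge ?Rintegral_set0// bnd_simp -ltNge.
  by rewrite subr0.
have -> : \int[leb]_(t in `[0, z]) expR (- t ^+ 2) = 0.
  by rewrite set_itv_ge ?Rintegral_set0// bnd_simp -ltNge.
by rewrite sub0r -(gauss_primitiveB (ltW z0)) opprB.
Qed.

Lemma ler_erf : {mono (@erf R) : x y / x <= y}.
Proof.
apply: le_mono => x y xy; rewrite !erfE ltrD2r ltr_pM2l ?gauss_primitive_lt//.
by rewrite divr_gt0// sqrt_pi_gt0.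
Qed.

Lemma erf0 : erf (0 : R) = 0.
Proof. by rewrite erfE gauss_primitive0; field; rewrite gt_eqF// sqrt_pi_gt0. Qed.

(** Intermediate value theorem on [[0, b]], with [b] so large that the integral over it exceeds the
    target. The range [0, 1[ is where 2p - 1 lies when 1/2 <= p < 1. *)
Lemma erf_surj y : 0 <= y < 1 -> exists x, erf x = y.
Proof.
move=> /andP[y0 y1]; pose I := @gauss_integral_proof.integral0_gauss R.
have erfI x : 0 <= x -> erf x = 2 / spi * I x.
  move=> x0; rewrite /I /gauss_integral_proof.integral0_gauss -gauss_primitiveB// erfE.
  by rewrite gauss_primitive0; field; rewrite gt_eqF// sqrt_pi_gt0.
have spi0 := sqrt_pi_gt0.
(* The limit at hand is that of the squared integral, pi / 4, so [b] is first obtained from a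
   comparison of squares. *)
have [b [b0 yb]] : exists b, 0 < b /\ (spi / 2 * y) ^+ 2 < I b ^+ 2.
  have lt1 : (spi / 2 * y) ^+ 2 < pi / 4.
    have -> : pi / 4 = (spi / 2) ^+ 2 :> R.
      by rewrite exprMn sqr_sqrtr ?pi_ge0// exprVn; congr (_ / _); ring.
    rewrite ltrXn2r// ?nnegrE ?mulr_ge0 ?divr_ge0 ?sqrtr_ge0//.
    by rewrite gtr_pMr// divr_gt0.
  have /cvgr_gt /(_ _ lt1) ev := @gauss_integral_proof.cvg_integral0_gauss_sqr R.
  have [b []] := filter_ex (filterI (nbhs_pinfty_gt (num_real (0 : R))) ev).
  by exists b.
have Ib0 : 0 <= I b by exact: gauss_integral_proof.integral0_gauss_ge0.
have yIb : spi / 2 * y < I b.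
  by rewrite -(@ltr_pXn2r _ 2)// nnegrE// !mulr_ge0// ltW.
have [|||x xb Ix] := @IVT R I 0 b (spi / 2 * y).
- exact: ltW.
- by apply: parameterized_integral_continuous;
    [exact: ltW|exact: integrable_gauss].
- have -> : I 0 = 0.
    by rewrite /I /gauss_integral_proof.integral0_gauss set_itv1 Rintegral_set1.
  rewrite (min_idPl Ib0) (max_idPr Ib0) (ltW yIb) andbT.
  by rewrite !mulr_ge0// ?invr_ge0// ltW.
exists x; rewrite erfI; last by move: xb; rewrite in_itv/= => /andP[].
by rewrite Ix; field; rewrite gt_eqF.
Qed.

Lemma erfinvK y : 0 <= y < 1 -> erf (erfinv y) = y.
Proof.
move=> y01; have [x xy] := erf_surj y01.
(* Surjectivity rules out the branch in which [xget] returns its default. *)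
by rewrite /erfinv; case: xgetP => [x' _ //|/(_ x)].
Qed.

Lemma erfinv_ge0 y : 0 <= y < 1 -> 0 <= erfinv y.
Proof. by move=> y01; rewrite -ler_erf erf0 erfinvK//; case/andP: y01. Qed.

(** Standardization t = (x - mu) / (s sqrt 2): its derivative absorbs the whole peak of the density
    except the factor 1 / sqrt pi. *)
Lemma normal_prob_Nyc mu s y : 0 < s ->
  normal_prob mu s `]-oo, y] = ((1 + erf ((y - mu) / (s * Num.sqrt 2))) / 2)%:E.
Proof.
move=> s0; pose F x : R := (x - mu) / (s * Num.sqrt 2).
have s2 : 0 < Num.sqrt 2 :> R by rewrite sqrtr_gt0.
have ss0 : 0 < s * Num.sqrt 2 by rewrite mulr_gt0.
have F'E : F^`()%classic = cst (s * Num.sqrt 2)^-1.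
  apply/funext => x; rewrite /F derive1E deriveM// deriveD// derive_cst scaler0.
  by rewrite add0r derive_id derive_cst addr0 scaler1.
have -> : normal_prob mu s `]-oo, y] =
    (spi^-1%:E *
     \int[leb]_(x in `]-oo, y]) (((gauss_fun \o F) * F^`()%classic) x)%:E)%E.
  rewrite -ge0_integralZl//=; last 2 first.
  - apply/measurable_EFinP/measurable_funTS; rewrite F'E.
    apply: measurable_funM => //; apply: measurableT_comp => //.
      exact: measurable_gauss_fun.
    by apply: measurable_funM => //; exact: measurable_funB.
  - by move=> x _; rewrite F'E lee_fin mulr_ge0 ?gauss_fun_ge0//= invr_ge0 ltW.
  apply: eq_integral => x _; rewrite -EFinM; congr EFin.
  rewrite F'E normal_pdfE ?gt_eqF//= /normal_peak /normal_fun /gauss_fun /F.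
  rewrite [LHS]mulrC [RHS]mulrCA; congr (_ * _).
    congr expR; rewrite mulNr expr_div_n exprMn sqr_sqrtr//.
    by rewrite mulr_natr.
  rewrite -mulr_natr -mulrA sqrtrM ?sqr_ge0// sqrtr_sqr gtr0_norm//.
  by rewrite sqrtrM ?pi_ge0// mulrCA invfM.
rewrite -increasing_ge0_integration_by_substitutionNy//; first last.
- by move=> x _; exact: gauss_fun_ge0.
- by apply: continuous_subspaceT; exact: continuous_gauss_fun.
- apply/gt0_cvgMlNy; last exact: cvg_addrr_Ny.
  by rewrite invr_gt0.
- split.
    by move=> x _; rewrite /F; apply: derivableM.
  apply: cvg_at_left_filter; apply: cvgM; last exact: cvg_cst.
  by apply: cvgB; [exact: cvg_id|exact: cvg_cst].
- by rewrite F'E; exact: cvg_cst.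
- by rewrite F'E; exact: is_cvg_cst.
- by rewrite F'E => ? _; exact: cst_continuous.
- by move=> a b _ _ ab; rewrite /F ltr_pM2r ?invr_gt0// ltrD2r.
rewrite -[X in (_ * X)%E]fineK; last first.
  by apply: integrable_fin_num => //; exact: integrable_gauss.
rewrite -EFinM erfE; congr EFin.
by rewrite /gauss_primitive /Rintegral; field; rewrite gt_eqF// sqrt_pi_gt0.
Qed.

End gaussian_integral.

Lemma normal_rv_le_prob (R : realType) (d : measure_display)
    (T : measurableType d) (P : probability T R) (Y : T -> R) (mu s2 y p : R) :
  2^-1 <= p -> p < 1 -> normal_rv P Y mu s2 ->
  (p%:E <= P [set w | Y w <= y]%R)%E =
  (mu - y + Num.sqrt 2 * erfinv (2 * p - 1) * Num.sqrt s2 <= 0).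
Proof.
move=> p_ge p_lt [s2_ge0 _ lawY].
have -> : [set w | Y w <= y] = Y @^-1` `]-oo, y].
  by apply/seteqP; split => w /=; rewrite in_itv.
rewrite lawY//; have [->|s2_neq0] := eqVneq s2 0.
  (* For the Dirac mass the probability is 0 or 1; as 0 < p < 1, the constraint says mu <= y, which
     is the claimed inequality with zero deviation. *)
  rewrite sqrtr0 mulr0 addr0 subr_le0 diracE mem_setE in_itv/= lee_fin.
  by case: (mu <= y) => /=; lra.
have s_gt0 : 0 < Num.sqrt s2 by rewrite sqrtr_gt0 lt0r s2_neq0.
have sqrt2_gt0 : 0 < Num.sqrt 2 :> R by rewrite sqrtr_gt0.
rewrite normal_prob_Nyc// lee_fin.
(* Since 0 <= 2p - 1 < 1, this number is a value of [erf], and monotonicity reduces the constraint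
   to a comparison of arguments. *)
transitivity (erf (erfinv (2 * p - 1)) <=
              erf ((y - mu) / (Num.sqrt s2 * Num.sqrt 2))).
  rewrite erfinvK; last by apply/andP; split; lra.
  by apply/idP/idP; lra.
rewrite ler_erf ler_pdivlMr ?mulr_gt0// -subr_le0; congr (_ <= _); ring.
Qed.

(** * Euclidean norm of column vectors *)

Section euclidean_norm.
Context {R : realType}.

Lemma enorm_ge0 n (v : 'cV[R]_n) : 0 <= enorm v.
Proof. exact: sqrtr_ge0. Qed.

Lemma enorm_sqr n (v : 'cV[R]_n) : enorm v ^+ 2 = (v^T *m v) 0 0.
Proof.
rewrite sqr_sqrtr ?sumr_ge0// => [|i _]; last exact: sqr_ge0.
by rewrite mxE; apply: eq_bigr => i _; rewrite mxE expr2.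
Qed.

Lemma enormZ n (k : R) (v : 'cV[R]_n) : enorm (k *: v) = `|k| * enorm v.
Proof.
rewrite /enorm -sqrtr_sqr -sqrtrM ?sqr_ge0// mulr_sumr; congr Num.sqrt.
by apply: eq_bigr => i _; rewrite mxE exprMn.
Qed.

Lemma enorm_col_mx_sqr m n (u : 'cV[R]_m) (v : 'cV[R]_n) :
  enorm (col_mx u v) ^+ 2 = enorm u ^+ 2 + enorm v ^+ 2.
Proof. by rewrite !enorm_sqr tr_col_mx mul_row_col mxE. Qed.

Lemma enorm_scalar_sqr (k : R) : enorm (k%:M : 'cV[R]_1) ^+ 2 = k ^+ 2.
Proof. by rewrite enorm_sqr tr_scalar_mx -scalar_mxM mxE eqxx expr2. Qed.

End euclidean_norm.

(** * Gaussian process marginals and chance constraints affine in the dynamics *)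

Lemma gaussian_process_normal (d : measure_display) (T : measurableType d)
    (R : realType) (P : probability T R) (I : Type) (n : nat)
    (X : I -> T -> 'cV[R]_n) (mu : I -> 'cV[R]_n) (K : I -> I -> 'M[R]_n)
    (x : I) (a : 'cV[R]_n) :
  gaussian_process P X mu K ->
  normal_rv P (fun w => (a^T *m X x w) 0 0)
    ((a^T *m mu x) 0 0) ((a^T *m K x x *m a) 0 0).
Proof.
(* The marginal at the single point [x] is tested against [a] viewed as a one-block column; the
   block products then collapse to ordinary ones. *)
move=> /(_ 1 (fun=> x)) [_ /(_ (\mxcol_(_ < 1) a))].
rewrite tr_mxcol mul_mxrow_mxcol mul_mxrow_mxblock mul_mxrow_mxcol.
by under eq_fun do rewrite mul_mxrow_mxcol big_ord1; rewrite !big_ord1.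
Qed.

Section chance_constraint.
Context {R : realType} {n m : nat}.
Context {d : measure_display} {T : measurableType d} (P : probability T R).
Variables (F : 'cV[R]_n -> T -> 'M[R]_(n, 1 + m)).
Variables (M : 'cV[R]_n -> 'M[R]_(n, 1 + m)).
Variables (A : 'M[R]_n) (B : 'cV[R]_n -> 'cV[R]_n -> 'M[R]_(1 + m)).
Variables (x : 'cV[R]_n) (L : 'M[R]_(1 + m)) (u : 'cV[R]_m) (p : R).
Hypotheses (p_ge : 2^-1 <= p) (p_lt : p < 1).
Hypothesis factorB : B x x = L^T *m L.
Hypothesis gpF : gaussian_process P (fun x w => F x w *m ubar u)
  (fun x => M x *m ubar u)
  (fun x x' => ((ubar u)^T *m B x x' *m ubar u) 0 0 *: A).

(** The leading entry 1 of [ubar u] lets the constant terms of [CLC] and [CBC] be absorbed into the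
    vectors [q] and [e]. *)
Lemma col_mx_tr_ubar (k : R) : ((col_mx k%:M 0)^T *m ubar u) 0 0 = k.
Proof.
by rewrite tr_col_mx mul_row_col trmx0 mul0mx addr0 mulmx1 tr_scalar_mx mxE eqxx.
Qed.

Lemma affine_le_prob (a : 'cV[R]_n) (k y : R) :
  (p%:E <= P [set w | (a^T *m F x w *m ubar u) 0 0 + k <= y]%R)%E =
  ((((M x)^T *m a + col_mx k%:M 0)^T *m ubar u) 0 0 - y +
   Num.sqrt 2 * erfinv (2 * p - 1) *
     enorm (Num.sqrt ((a^T *m A *m a) 0 0) *: L *m ubar u) <= 0).
Proof.
have -> : [set w | (a^T *m F x w *m ubar u) 0 0 + k <= y] =
    [set w | (a^T *m (F x w *m ubar u)) 0 0 <= y - k].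
  by apply/seteqP; split => w /=; rewrite mulmxA lerBrDr.
rewrite (normal_rv_le_prob _ p_ge p_lt (gaussian_process_normal x a gpF)).
(* The variance splits as (ubar^T B ubar)(a^T A a), and the Cholesky factor makes the first factor
   the square of |L ubar|. *)
have -> : enorm (Num.sqrt ((a^T *m A *m a) 0 0) *: L *m ubar u) =
    Num.sqrt ((a^T *m (((ubar u)^T *m B x x *m ubar u) 0 0 *: A) *m a) 0 0).
  rewrite -scalemxAl enormZ ger0_norm ?sqrtr_ge0// factorB.
  rewrite -scalemxAr -scalemxAl [in RHS]mxE.
  have -> : (ubar u)^T *m (L^T *m L) *m ubar u = (L *m ubar u)^T *m (L *m ubar u).
    by rewrite trmx_mul !mulmxA.
  rewrite -enorm_sqr sqrtrM ?sqr_ge0//.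
  by rewrite sqrtr_sqr ger0_norm ?enorm_ge0// mulrC.
congr (_ + _ <= _); rewrite [(_ + _)^T]linearD /= mulmxDl trmx_mul trmxK mulmxA.
by rewrite [in RHS]mxE col_mx_tr_ubar; ring.
Qed.

(** Negating [a], [k] and [y] reduces this to the upper-bound case; the deviation is unchanged
    because it is even in [a]. *)
Lemma affine_ge_prob (a : 'cV[R]_n) (k y : R) :
  (p%:E <= P [set w | y <= (a^T *m F x w *m ubar u) 0 0 + k]%R)%E =
  (0 <= (((M x)^T *m a + col_mx k%:M 0)^T *m ubar u) 0 0 - y -
   Num.sqrt 2 * erfinv (2 * p - 1) *
     enorm (Num.sqrt ((a^T *m A *m a) 0 0) *: L *m ubar u)).
Proof.
have -> : [set w | y <= (a^T *m F x w *m ubar u) 0 0 + k] =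
    [set w | ((- a)^T *m F x w *m ubar u) 0 0 + - k <= - y].
  apply/seteqP; split => w /=; rewrite [(- a)^T]linearN /= !mulNmx;
    rewrite [(- (a^T *m _ *m _)) 0 0]mxE; lra.
rewrite affine_le_prob [(- a)^T]linearN /= !mulNmx !mulmxN !opprK.
have -> : col_mx (- k)%:M 0 = - col_mx k%:M 0 :> 'cV[R]_(1 + m).
  by rewrite opp_col_mx oppr0 raddfN.
rewrite -opprD [(- (_ + _))^T]linearN /= mulNmx [(- (_ *m _)) 0 0]mxE.
by apply/idP/idP; lra.
Qed.

End chance_constraint.

(** * Second-order cone form and equivalence of the two programs *)

Lemma second_order_cone_constraintP (R : realType) (E : lmodType R) (k : nat)
    (C : E -> 'cV[R]_k) (b : 'cV[R]_k) (l : E -> R) (c : R) (S : set E) :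
  linear C -> scalar l -> (forall z, S z = (enorm (C z + b) <= l z + c)) ->
  second_order_cone_constraint S.
Proof.
move=> linC linl SE.
pose C' : {linear E -> 'cV[R]_k} := HB.pack C (GRing.isLinear.Build _ _ _ _ C linC).
pose l' : {scalar E} := HB.pack l (GRing.isLinear.Build _ _ _ _ l linl).
by exists k, C', b, l', c; apply/funext => z; rewrite SE.
Qed.

Theorem proposition4
  (R : realType) (n m : nat)
  (d : measure_display) (T : measurableType d) (P : probability T R)
  (f : 'cV[R]_n -> T -> 'cV[R]_n) (g : 'cV[R]_n -> T -> 'M[R]_(n, m))
  (V h : 'cV[R]_n -> R) (gamma alpha : R -> R)
  (M : 'cV[R]_n -> 'M[R]_(n, 1 + m))
  (A : 'M[R]_n)
  (B : 'cV[R]_n -> 'cV[R]_n -> 'M[R]_(1 + m))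
  (xk : 'cV[R]_n) (Bhalf : 'M[R]_(1 + m))
  (U : set 'cV[R]_m) (Rw : 'cV[R]_n -> 'M[R]_m)
  (lambda zeta p : R)
  (hV : continuously_differentiable V)
  (hh : continuously_differentiable h)
  (hgamma : class_K gamma)
  (halpha : extended_class_Kinfty alpha)
  (hA : psd A)
  (hB : forall x, psd (B x x))
  (hBhalf : cholesky_factor (B xk xk) Bhalf)
  (hU : convex_set U)
  (hlambda : 0 < lambda) (hzeta : 0 < zeta)
  (hp1 : 2^-1 <= p) (hp2 : p < 1)
  (hGP : forall u : 'cV[R]_m,
    gaussian_process P
      (fun x w => dynamics f g x w *m ubar u)
      (fun x => M x *m ubar u)
      (fun x x' => ((ubar u)^T *m B x x' *m ubar u) 0 0 *: A)) :
  let F := dynamics f g in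
  let c : R := Num.sqrt 2 * erfinv (2 * p - 1) in
  let q : 'cV[R]_(1 + m) := (M xk)^T *m grad V xk + col_mx (gamma (V xk))%:M 0 in
  let Pk : 'M[R]_(1 + m) :=
    Num.sqrt (((grad V xk)^T *m A *m grad V xk) 0 0) *: Bhalf in
  let e : 'cV[R]_(1 + m) := (M xk)^T *m grad h xk + col_mx (alpha (h xk))%:M 0 in
  let Vk : 'M[R]_(1 + m) :=
    Num.sqrt (((grad h xk)^T *m A *m grad h xk) 0 0) *: Bhalf in
  let chance_objective := fun z : 'cV[R]_m * R =>
    let '(u, delta) := z in
    enorm (Rw xk *m u) ^+ 2 + lambda * delta ^+ 2 in
  let chance_feasible := [set z : 'cV[R]_m * R |
    let '(u, delta) := z in
    [/\ U u,
        (p%:E <= P [set w | CLC F V gamma xk u w <= delta]%R)%E &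
        (p%:E <= P [set w | zeta <= CBC F h alpha xk u w]%R)%E]] in
  let cone_objective := fun z : R^o * R^o * 'cV[R]_m =>
    let '(y, delta, u) := z in (y : R) in
  let cone_feasible := [set z : R^o * R^o * 'cV[R]_m |
    let '(y, delta, u) := z in
    [/\ U u,
        0 <= y - enorm (col_mx (Rw xk *m u) (Num.sqrt lambda * delta)%:M),
        (q^T *m ubar u) 0 0 - delta + c * enorm (Pk *m ubar u) <= 0 &
        0 <= (e^T *m ubar u) 0 0 - zeta - c * enorm (Vk *m ubar u)]] in
  second_order_cone_program
    [set z : R^o * R^o * 'cV[R]_m | U z.2] cone_feasible cone_objective /\
  forall (u : 'cV[R]_m) (delta : R),
    minimizer chance_feasible chance_objective (u, delta) <->
    exists y : R, minimizer cone_feasible cone_objective (y, delta, u).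

Proof.
move=> F c q Pk e Vk chance_objective chance_feasible cone_objective cone_feasible.
(* Here p >= 1/2 gives 2p - 1 >= 0. The sign of [c] later allows it to be moved inside the norms. *)
have c_ge0 : 0 <= c.
  by rewrite mulr_ge0 ?sqrtr_ge0// erfinv_ge0//; apply/andP; split; lra.
pose N u delta := enorm (col_mx (Rw xk *m u) (Num.sqrt lambda * delta)%:M).
have objE u delta : chance_objective (u, delta) = N u delta ^+ 2.
  rewrite /N enorm_col_mx_sqr enorm_scalar_sqr exprMn.
  by rewrite (sqr_sqrtr (ltW hlambda)).
(* Cone feasibility splits into chance feasibility of the pair and the epigraph bound on [y]; both
   directions on minimizers rest on this. *)
have coneE y u delta :
    cone_feasible (y, delta, u) <-> chance_feasible (u, delta) /\ N u delta <= y.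
  have [_ BE] := hBhalf.
  rewrite /cone_feasible /chance_feasible /CLC /CBC /=.
  rewrite (affine_le_prob hp1 hp2 BE (hGP u)) (affine_ge_prob hp1 hp2 BE (hGP u)).
  by rewrite subr_ge0; split=> [[]|[[]]].
split; last first.
  move=> u delta; split=> [[feas opt]|[y [/coneE[feas Ny] opt]]].
    (* The smallest [y] allowed above [(u, delta)] makes the epigraph constraint tight. *)
    exists (N u delta); split; first exact/coneE.
    move=> [[y' delta'] u'] /coneE[/opt]; rewrite !objE => le_sqr.
    apply: le_trans; rewrite -(@ler_pXn2r _ 2)// nnegrE; exact: enorm_ge0.
  split=> // -[u' delta'] feas'; rewrite !objE.
  (* Each competitor is lifted to its own tight triple, so that optimality gives N u delta <= y <= N
     u' delta'. *)
  have /opt /= yN' : cone_feasible (N u' delta', delta', u') by exact/coneE.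
  by rewrite lerXn2r ?nnegrE ?enorm_ge0// (le_trans Ny).
(* [ubar] is only affine: [up] is its linear part, and the remaining constant column feeds the
   offsets of the cone constraints. *)
pose up (u : 'cV[R]_m) : 'cV[R]_(1 + m) := col_mx 0 u.
have ubarE u : ubar u = up u + col_mx 1%:M 0 by rewrite add_col_mx add0r addr0.
have upP k u u' : up (k *: u + u') = k *: up u + up u'.
  by rewrite /up scale_col_mx add_col_mx scaler0 addr0.
have linup (G : 'rV[R]_(1 + m)) k u u' :
    (G *m up (k *: u + u')) 0 0 = k * (G *m up u) 0 0 + (G *m up u') 0 0.
  by rewrite upP mulmxDr -scalemxAr !mxE.
split.
- move=> x y l; rewrite !inE => Ux Uy.
  by have := hU x.2 y.2 l; rewrite !inE; exact.
- pose fst11 (z : R^o * R^o * 'cV[R]_m) : R := z.1.1.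
  have lin_fst11 : scalar fst11 by [].
  pose l : {scalar (R^o * R^o * 'cV[R]_m)%type} :=
    HB.pack fst11 (GRing.isLinear.Build _ _ _ _ fst11 lin_fst11).
  exists l.
  by apply/funext => -[[y delta] u].
pose S1 := [set z : R^o * R^o * 'cV[R]_m | N z.2 z.1.2 <= z.1.1].
pose S2 := [set z : R^o * R^o * 'cV[R]_m |
  (q^T *m ubar z.2) 0 0 - z.1.2 + c * enorm (Pk *m ubar z.2) <= 0].
pose S3 := [set z : R^o * R^o * 'cV[R]_m |
  0 <= (e^T *m ubar z.2) 0 0 - zeta - c * enorm (Vk *m ubar z.2)].
(* The cones are the epigraph, the Lyapunov constraint and the barrier constraint. *)
exists 3%N, (tnth [tuple S1; S2; S3]); split; last first.
  apply/seteqP; split=> [[[y delta] u] [Uu h1 h2 h3]|[[y delta] u] [Uu hS]].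
    split=> // -[[|[|[|?]]] hi] _ //=; rewrite (tnth_nth S1) //=.
    by rewrite /S1 /= -subr_ge0.
  have h1 := hS (inord 0) I; have h2 := hS (inord 1) I; have h3 := hS (inord 2) I.
  move: h1 h2 h3; rewrite !(tnth_nth S1) !inordK//= /S1 /= -subr_ge0.
  by split.
move=> [[|[|[|?]]] hi] //=; rewrite (tnth_nth S1) /=.
- apply: (@second_order_cone_constraintP _ _ _
    (fun z => col_mx (Rw xk *m z.2) (Num.sqrt lambda * z.1.2)%:M) 0
    (fun z => z.1.1) 0) => //.
    move=> k [[y1 d1] u1] [[y2 d2] u2] /=.
    rewrite mulmxDr -scalemxAr scale_col_mx add_col_mx; congr col_mx.
    by rewrite scale_scalar_mx -raddfD /=; congr (_%:M); rewrite mulrDr mulrCA.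
  by move=> [[y1 d1] u1]; rewrite /S1 /= !addr0.
- apply: (@second_order_cone_constraintP _ _ _
    (fun z => c *: (Pk *m up z.2)) (c *: (Pk *m col_mx 1%:M 0))
    (fun z => z.1.2 - (q^T *m up z.2) 0 0) (- (q^T *m col_mx 1%:M 0) 0 0)).
  + move=> k z1 z2 /=; rewrite upP mulmxDr -scalemxAr scalerDr !scalerA.
    by rewrite mulrC.
  + move=> k [[? d1] ?] [[? d2] ?] /=; rewrite linup.
    by rewrite mulrBr opprD addrACA.
  (* As [c] is nonnegative, c |Pk ubar| = |c Pk ubar|, which is the norm of an affine function of
     the variables. *)
  + move=> z; rewrite /S2 /= -scalerDr -mulmxDr -ubarE enormZ ger0_norm//.
    rewrite {1}ubarE mulmxDr mxE; apply/propext; split; lra.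
- apply: (@second_order_cone_constraintP _ _ _
    (fun z => c *: (Vk *m up z.2)) (c *: (Vk *m col_mx 1%:M 0))
    (fun z => (e^T *m up z.2) 0 0) ((e^T *m col_mx 1%:M 0) 0 0 - zeta)).
  + move=> k z1 z2 /=; rewrite upP mulmxDr -scalemxAr scalerDr !scalerA.
    by rewrite mulrC.
  + by move=> k z1 z2 /=; rewrite linup.
  + move=> z; rewrite /S3 /= -scalerDr -mulmxDr -ubarE enormZ ger0_norm//.
    rewrite {1}ubarE mulmxDr mxE; apply/propext; split; lra.
Qed.
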